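(* Let \(\alpha\) and \(\beta\) be ordinals with \(|\alpha|\geq|\beta|\). If \(\alpha+\beta\) is CRITTM-clockable, then \(\beta\) is countable.
   Context: An infinite time Turing machine (ITTM) has three tapes, each with cells indexed by \(\omega\) holding 0 or 1, a head, and a finite program with finitely many states including a start, a halt and a special \emph{limit} state. At successor stages it acts as an ordinary Turing machine; at limit ordinal stages the head is placed on the first cell, the state is the limit state, and each cell's value is the \(\limsup\) of its previous values. A cardinal-recognizing ITTM (CRITTM) has the same hardware and behaviour, except that it has an additional special \emph{cardinal} state: at every uncountable cardinal stage, the head is on the first cell, the machine is in the cardinal state, and cell values are the \(\limsup\) of previous values; at other limit stages it behaves like an ITTM. An ordinal \(\delta\) is CRITTM-clockable if some CRITTM program, run on empty (all-zero) input, halts at exactly stage \(\delta\). \(|\alpha|\) denotes the cardinality of \(\alpha\). *)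

(* Defs.v *)
From HB Require Import structures.
From mathcomp Require Import all_boot.
From mathcomp Require Import boolp classical_sets functions cardinality wochoice.
Set Implicit Arguments.
Unset Strict Implicit.
Unset Printing Implicit Defensive.

Local Open Scope classical_set_scope.
Local Open Scope card_scope.

(* Ordinals are represented by well-ordered types; all the notions below are
   invariant under order isomorphism. *)
Record ord := Ord {
  ord_sort :> Type;
  ord_le : rel ord_sort;
  ord_wo : well_order ord_le }.

Definition ord_lt (W : ord) (x y : W) : bool := ~~ ord_le y x.

Section Sum.
Variables V W : ord.

Definition sum_le : rel (V + W) := fun u v =>
  match u, v with
  | inl x, inl y => ord_le x y
  | inl _, inr _ => true
  | inr _, inl _ => false
  | inr x, inr y => ord_le x y
  end.

Lemma sum_le_wo : well_order sum_le.
Proof.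
move=> A [u Au].
have [[x Ax]|noV] := pselect (exists x : V, (inl x : V + W) \in A).
  have [m [[mA mlb] muniq]] :=
    @ord_wo V [pred x : V | (inl x : V + W) \in A] (ex_intro _ x Ax).
  exists (inl m); split.
    split=> // -[y Ay|//]; exact: mlb.
  case=> [y [Ay ylb]|y [_ /(_ (inl x) Ax)]//].
  congr inl; apply: muniq; split=> // z Az; exact: (ylb (inl z)).
case: u Au => [x Ax|x Ax]; first by case: noV; exists x.
have [m [[mA mlb] muniq]] :=
  @ord_wo W [pred x : W | (inr x : V + W) \in A] (ex_intro _ x Ax).
exists (inr m); split.
  split=> // -[y Ay|y Ay]; last exact: mlb.
  by case: noV; exists y.
case=> [y [Ay _]|y [Ay ylb]]; first by case: noV; exists y.
congr inr; apply: muniq; split=> // z Az; exact: (ylb (inr z)).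
Qed.

Definition ord_add : ord := Ord sum_le_wo.

End Sum.

Lemma unit_le_wo : well_order (fun _ _ : unit => true).
Proof. by move=> A [[] At]; exists tt; split=> // -[]. Qed.

Definition ord_one : ord := Ord unit_le_wo.

Definition ord_succ (W : ord) : ord := ord_add W ord_one.

Definition ord_top (W : ord) : ord_succ W := inr tt.

Section Stages.
Variable W : ord.
Implicit Types x y z : W.

Definition initial_segment x : set W := [set y | ord_lt y x].

Definition is_zero x : Prop := forall y, ~~ ord_lt y x.

Definition is_succ_of x y : Prop :=
  ord_lt x y /\ forall z, ~~ (ord_lt x z && ord_lt z y).

Definition is_limit x : Prop :=
  ~ is_zero x /\ forall y, ~ is_succ_of y x.

(* A point of [W] stands for the ordinal of its predecessors: it is a cardinal
   when it is not equinumerous to any smaller ordinal. *)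
Definition is_cardinal x : Prop :=
  forall y, ord_lt y x -> ~ (initial_segment y #= initial_segment x).

Definition is_uncountable_cardinal x : Prop :=
  is_cardinal x /\ ~ countable (initial_segment x).

(* limsup_(y -> x) f y = inf_(z < x) sup_(z <= y < x) f y in {0, 1}. *)
Definition limsup_below (f : W -> bool) x : bool :=
  `[< forall z, ord_lt z x ->
      exists y, [/\ ord_le z y, ord_lt y x & f y] >].

End Stages.

Variant direction := MoveLeft | MoveRight.

(* One head reads and writes the three tapes simultaneously. *)
Record crittm := Crittm {
  state : finType;
  start_state : state;
  halt_state : state;
  limit_state : state;
  cardinal_state : state;
  special_states_uniq :
    uniq [:: start_state; halt_state; limit_state; cardinal_state];
  transition : state -> {ffun 'I_3 -> bool} ->
    state * {ffun 'I_3 -> bool} * direction }.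

Record config (M : crittm) := Config {
  cstate : state M;
  chead : nat;
  ctape : 'I_3 -> nat -> bool }.

Definition initial_config (M : crittm) : config M :=
  Config (start_state M) 0 (fun _ _ => false).

(* [n.-1] leaves the head in place when it moves left from the first cell. *)
Definition move_head (d : direction) (n : nat) : nat :=
  match d with MoveLeft => n.-1 | MoveRight => n.+1 end.

Definition step (M : crittm) (c : config M) : config M :=
  let: (q, w, d) :=
    transition (cstate c) [ffun i => ctape c i (chead c)] in
  Config q (move_head d (chead c))
    (fun i n => if n == chead c then w i else ctape c i n).

Definition limsup_config (M : crittm) (W : ord) (q : state M)
    (r : W -> config M) (x : W) : config M :=
  Config q 0 (fun i n => limsup_below (fun y => ctape (r y) i n) x).

Record is_run (M : crittm) (W : ord) (r : W -> config M) : Prop := IsRun {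
  run_zero : forall x, is_zero x -> r x = initial_config M;
  run_succ : forall x y, is_succ_of x y -> r y = step (r x);
  run_cardinal : forall x, is_uncountable_cardinal x ->
    r x = limsup_config (cardinal_state M) r x;
  run_limit : forall x, is_limit x -> ~ is_uncountable_cardinal x ->
    r x = limsup_config (limit_state M) r x }.

(* As usual for clockable ordinals, the computation halts at stage [delta] when
   the step performed at stage [delta], leading to stage [delta + 1], is the one
   that moves to the halt state. The stages up to [delta] included are the
   points of [ord_succ delta]. Requiring the halt state already at stage
   [delta] would rule out every limit ordinal. *)
Definition halts_at (M : crittm) (delta : ord) : Prop :=
  exists r : ord_succ delta -> config M,
    [/\ is_run r,
        forall x, cstate (r x) <> halt_state M &
        cstate (step (r (ord_top delta))) = halt_state M].

Definition crittm_clockable (delta : ord) : Prop :=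
  exists M : crittm, halts_at M delta.

(* Main.v *)
(* Suppose that beta is uncountable. As |beta| <= |alpha|, no stage x with
   alpha < x <= alpha + beta is a cardinal, so past alpha the machine is an ordinary
   ITTM, and it reaches stage o = alpha + omega_1. A closing-off argument on the
   countably many cells gives a stage d < o with the configuration of o such that the
   cells that are 0 at o stay 0 on [d, o). Limsups preserve this, so from d on the
   run repeats the block [d, o) forever, at limits of blocks too, and never halts. *)
Require Import Defs.
From mathcomp Require Import all_boot.
From mathcomp Require Import boolp classical_sets functions cardinality.
Set Implicit Arguments.
Unset Strict Implicit.
Unset Printing Implicit Defensive.
Local Open Scope classical_set_scope.
Local Open Scope card_scope.

(** * Well-orders: order laws, induction, successors and limits *)

Section WellOrder.
Variable W : ord.
Implicit Types (x y z : W) (P : W -> Prop).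

Lemma exists_least P : (exists x, P x) ->
  exists m, P m /\ forall x, P x -> ord_le m x.
Proof.
move=> [x Px]; have [] := @ord_wo W [pred y | `[< P y >]].
  by exists x; apply/asboolP.
move=> m [[/asboolP Pm mlb] _]; exists m; split=> // y Py.
by apply: mlb; apply/asboolP.
Qed.

(** The order laws are not axioms here but come from least elements: of [{x}] for reflexivity, of
    [{x, y}] for totality and, by uniqueness, antisymmetry, of [{x, y, z}] for transitivity. *)
Lemma ord_lexx x : ord_le x x.
Proof. by have [m [-> h]] := exists_least (ex_intro (eq^~ x) x erefl); exact: h. Qed.
Hint Resolve ord_lexx : core.

Lemma ord_le_total x y : ord_le x y \/ ord_le y x.
Proof.
have [|m [[->|->] h]] := @exists_least (fun z => z = x \/ z = y).
- by exists x; left.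
- by left; apply: h; right.
- by right; apply: h; left.
Qed.

Lemma ord_le_anti x y : ord_le x y -> ord_le y x -> x = y.
Proof.
move=> xy yx; have [] := @ord_wo W [pred z | `[< z = x \/ z = y >]].
  by exists x; apply/asboolP; left.
move=> m [_ uniq]; rewrite -(uniq x) ?(uniq y)//.
  split; first by apply/asboolP; right.
  by move=> z /asboolP[]->.
split; first by apply/asboolP; left.
by move=> z /asboolP[]->.
Qed.

Lemma ord_ltNge x y : ord_lt x y = ~~ ord_le y x.
Proof. by []. Qed.

Lemma ord_leNgt x y : ord_le x y = ~~ ord_lt y x.
Proof. by rewrite /ord_lt negbK. Qed.

Lemma ord_ltxx x : ord_lt x x = false.
Proof. by rewrite /ord_lt ord_lexx. Qed.

Lemma ord_ltW x y : ord_lt x y -> ord_le x y.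
Proof. by move=> /negP xy; have [] := ord_le_total x y. Qed.

Lemma ord_le_trans y x z : ord_le x y -> ord_le y z -> ord_le x z.
Proof.
move=> xy yz; have [|m [Pm h]] := @exists_least (fun u => [\/ u = x, u = y | u = z]).
  by exists x; constructor 1.
have [hx hy hz] : [/\ ord_le m x, ord_le m y & ord_le m z].
  by split; apply: h; [constructor 1|constructor 2|constructor 3].
case: Pm => e; subst m => //.
  by rewrite (ord_le_anti xy hx).
by rewrite -(ord_le_anti yz hy).
Qed.

Lemma ord_lt_le_trans y x z : ord_lt x y -> ord_le y z -> ord_lt x z.
Proof. by move=> xy yz; apply: contra xy => zx; exact: ord_le_trans zx. Qed.

Lemma ord_le_lt_trans y x z : ord_le x y -> ord_lt y z -> ord_lt x z.
Proof. by move=> xy yz; apply: contra yz => zx; exact: ord_le_trans xy. Qed.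

Lemma ord_lt_trans y x z : ord_lt x y -> ord_lt y z -> ord_lt x z.
Proof. by move=> xy /ord_ltW; exact: ord_lt_le_trans. Qed.

Lemma ord_le_eqVlt x y : ord_le x y -> x = y \/ ord_lt x y.
Proof.
move=> xy; have [yx|] := boolP (ord_le y x); last by right.
by left; exact: ord_le_anti.
Qed.

Lemma ord_leVgt x y : ord_le x y \/ ord_lt y x.
Proof. by have [|] := boolP (ord_le x y); [left|right]. Qed.

Lemma ord_lt_ind P :
  (forall x, (forall y, ord_lt y x -> P y) -> P x) -> forall x, P x.
Proof.
move=> IH x; apply: contrapT => nPx.
have [m [nPm h]] := exists_least (ex_intro (fun x => ~ P x) x nPx).
by apply: nPm; apply: IH => y /negP ym; apply: contrapT => /h.
Qed.

Lemma ord_lt_wf : well_founded (fun x y : W => ord_lt x y : Prop).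
Proof. by apply: ord_lt_ind => x IH; constructor. Qed.

Lemma exists_ord_max x y :
  exists m, [/\ ord_le x m, ord_le y m &
    forall z, ord_lt x z -> ord_lt y z -> ord_lt m z].
Proof. by have [xy|yx] := ord_le_total x y; [exists y|exists x]; split. Qed.

Lemma is_succ_of_le x y z : is_succ_of x y -> ord_lt z y -> ord_le z x.
Proof. by move=> [_ /(_ z)] + zy; rewrite zy andbT -ord_leNgt. Qed.

Lemma is_succ_of_inj x x' y : is_succ_of x y -> is_succ_of x' y -> x = x'.
Proof.
move=> h h'; apply: ord_le_anti; first exact: is_succ_of_le h' h.1.
exact: is_succ_of_le h h'.1.
Qed.

Lemma exists_succ x y : ord_lt x y -> exists z, is_succ_of x z /\ ord_le z y.
Proof.
move=> xy; have [z [xz h]] := exists_least (ex_intro (fun z => ord_lt x z) y xy).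
exists z; split; last exact: h.
by split=> // u; apply/negP => /andP[/h]; rewrite ord_leNgt => /negP.
Qed.

Lemma is_limit_lt x y : is_limit x -> ord_lt y x ->
  exists z, is_succ_of y z /\ ord_lt z x.
Proof.
move=> [_ xS] yx; have [z [yz zx]] := exists_succ yx; exists z; split=> //.
by have [zE|//] := ord_le_eqVlt zx; case: (xS y); rewrite -zE.
Qed.

Lemma succ_or_limit x y : ord_lt x y -> (exists p, is_succ_of p y) \/ is_limit y.
Proof.
move=> xy; have [|nS] := pselect (exists p, is_succ_of p y); first by left.
by right; split=> [/(_ x)/negP//|p py]; apply: nS; exists p.
Qed.

Lemma is_limit_intro x y : ord_lt x y ->
  (forall z, ord_lt z y -> exists2 u, ord_lt z u & ord_lt u y) -> is_limit y.
Proof.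
move=> xy h; split=> [/(_ x)/negP//|p [py pS]].
by have [u pu uy] := h _ py; have := pS u; rewrite pu uy.
Qed.

End WellOrder.
#[export] Hint Resolve ord_lexx : core.

(** * Cardinal arithmetic: an infinite initial segment absorbs any set that is no larger *)

Lemma card_le_fun T U (A : set T) (B : set U) (u0 : U) : A #<= B ->
  exists f : T -> U, (forall x, A x -> B (f x)) /\
    (forall x y, A x -> A y -> f x = f y -> x = y).
Proof.
elim/Ppointed: U => U in B u0 *; first by case: (no u0).
move=> /pcard_leP/injfunPex[f fAB fI]; exists f; split=> [x /fAB//|x y Ax Ay].
by apply: fI; apply/mem_set.
Qed.

Lemma fun_card_le T U (A : set T) (B : set U) (f : T -> U) :
  (forall x, A x -> B (f x)) ->
  (forall x y, A x -> A y -> f x = f y -> x = y) -> A #<= B.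
Proof.
move=> fAB fI; rewrite -(card_le_eql (@inj_card_eq _ _ A f _)).
  by apply: subset_card_le => _ [x Ax <-]; exact: fAB.
by move=> x y /set_mem Ax /set_mem Ay; exact: fI.
Qed.

(** An injection of two disjoint copies of [A] into [A]; the boolean selects the copy, and [g] is
    arbitrary outside [A]. *)
Definition doubled T (A : set T) := exists g : bool -> T -> T,
  (forall b x, A x -> A (g b x)) /\
  (forall b c x y, A x -> A y -> g b x = g c y -> b = c /\ x = y).

(** Points of [A] go into the [true] copy; the other points of [B] are first injected into [A], then
    go into the [false] copy. *)
Lemma card_setU_doubled T (A B : set T) :
  doubled A -> B #<= A -> A `|` B #= A.
Proof.
move=> [g [gA gI]] BA; apply/card_eqPle; split; last exact: subset_card_le.
have [[x Bx]|B0] := pselect (exists x, B x); last first.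
  by rewrite (_ : B = set0) ?setU0// -subset0 => x Bx; case: B0; exists x.
have [f [fA fI]] := card_le_fun x BA.
pose h z := if pselect (A z) then g true z else g false (f z).
have hE z : (A `|` B) z -> h z = g true z /\ A z \/ h z = g false (f z) /\ B z.
  by rewrite /h; case: pselect => Az []; auto.
apply: (@fun_card_le _ _ _ _ h) => [z /hE[] [-> ?]|y z /hE yE /hE zE].
- exact: gA.
- by apply: gA; exact: fA.
case: yE zE => [] [-> ?] [] [-> ?] /gI[]//; try exact: fA.
by move=> _; exact: fI.
Qed.

Lemma doubled_card_eq T U (A : set T) (B : set U) (u0 : U) :
  A #= B -> doubled A -> doubled B.
Proof.
move=> /card_eqPle[AB BA] [g [gA gI]].
have [B0|/existsNP[u1 /contrapT Bu1]] := pselect (forall u, ~ B u).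
  exists (fun _ => id); split=> // b c x y /B0//.
have [f [fB fI]] := card_le_fun u0 AB.
have [t0 _] : exists t : T, True.
  apply: contrapT => nT; have A0 : A = set0 by rewrite -subset0 => t; case: nT; exists t.
  by move: BA; rewrite A0 => /card_le0P B0; move: Bu1; rewrite B0.
have [h [hA hI]] := card_le_fun t0 BA.
exists (fun b u => f (g b (h u))); split=> [b u Bu|b c u v Bu Bv].
  by apply: fB; apply: gA; exact: hA.
by move=> /fI/gI[]; try (by try apply: gA; exact: hA); split=> //; exact: hI.
Qed.

(* Every element of a limit ordinal is uniquely [l + n] with [n] finite and [l]
   zero or limit; send it to [l + 2n] and [l + 2n + 1]. *)
Lemma doubled_limit (W : ord) (x : W) :
  (forall y, ord_lt y x -> exists z, is_succ_of y z /\ ord_lt z x) ->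
  doubled (initial_segment x).
Proof.
move=> xS; have [S SP] : {S : W -> W & forall y, ord_lt y x ->
    is_succ_of y (S y) /\ ord_lt (S y) x}.
  apply: (@choice _ _
    (fun y z => ord_lt y x -> is_succ_of y z /\ ord_lt z x)) => y.
  have [/xS[z zP]|yx] := pselect (ord_lt y x); first by exists z.
  by exists y.
pose base l := ord_lt l x /\ forall p, ~ is_succ_of p l.
have iterx l n : ord_lt l x -> ord_lt (iter n S l) x.
  by move=> lx; elim: n => //= n /SP[].
have iterI l m n k : base l -> base m -> iter n S l = iter k S m -> n = k /\ l = m.
  move=> [lx lS] [mx mS]; elim: n k => [|n IH] [|k] //= E.
  - by case: (lS (iter k S m)); rewrite E; apply: (SP _ _).1; exact: iterx.
  - by case: (mS (iter n S l)); rewrite -E; apply: (SP _ _).1; exact: iterx.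
  have [|-> ->//] := IH k.
  have := (SP _ (iterx _ n lx)).1; rewrite E => h.
  by apply: is_succ_of_inj h (SP _ (iterx _ k mx)).1.
have ex y : exists ln : W * nat, ord_lt y x -> base ln.1 /\ y = iter ln.2 S ln.1.
  have [yx|] := pselect (ord_lt y x); last by exists (y, 0).
  elim/ord_lt_ind: y => y IH in yx *.
  have [[p py]|nS] := pselect (exists p, is_succ_of p y).
    have px := ord_lt_trans py.1 yx.
    have [[l n] /= h] := IH _ py.1 px; have [bl pE] := h px; exists (l, n.+1) => /= _.
    split=> //; rewrite -pE; have [pS _] := SP _ px.
    apply: ord_le_anti; rewrite ord_leNgt; apply/negP.
      by move=> /(is_succ_of_le py); rewrite ord_leNgt pS.1.
    by move=> /(is_succ_of_le pS); rewrite ord_leNgt py.1.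
  by exists (y, 0) => _; split=> //; split=> // p py; apply: nS; exists p.
have [d dP] := choice ex.
exists (fun b y => iter ((d y).2.*2 + b) S (d y).1); split=> [b y /dP[[] lx _ _]|].
  exact: iterx.
move=> b c y z /dP[by_ yE] /dP[bz zE] /iterI[]// nE lE.
(* The parity of the finite part tells the two copies apart. *)
have bE : b = c by have := congr1 odd nE; rewrite !oddD !odd_double !oddb.
split=> //; rewrite yE zE lE; congr iter.
by move: nE; rewrite bE => /addIn/double_inj.
Qed.

(** Induction strips the final successors: removing the last point of an infinite segment keeps its
    cardinality, because the doubled smaller segment absorbs a singleton. A stage that is no
    successor falls under [doubled_limit]. *)
Lemma doubled_initial_segment (W : ord) (x : W) :
  infinite_set (initial_segment x) -> doubled (initial_segment x).
Proof.
elim/ord_lt_ind: x => x IH xoo.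
have [[p px]|nS] := pselect (exists p, is_succ_of p x); last first.
  apply: doubled_limit => y yx; have [z [yz zx]] := exists_succ yx; exists z; split=> //.
  by have [zE|//] := ord_le_eqVlt zx; case: nS; exists y; rewrite -zE.
have E : initial_segment x = initial_segment p `|` [set p].
  apply/seteqP; split=> [y /(is_succ_of_le px)|y [yp|->]].
  - by move=> /ord_le_eqVlt[->|]; [right|left].
  - exact: ord_lt_trans yp px.1.
  - exact: px.1.
have poo : infinite_set (initial_segment p).
  by move=> pfin; apply: xoo; rewrite E finite_setU; split=> //; exact: finite_set1.
have /IH := px.1 => /(_ poo) dp; rewrite E.
apply: (@doubled_card_eq _ _ (initial_segment p)) => //.
rewrite card_eq_sym; apply: card_setU_doubled => //.
have [y py] := infinite_setN0 poo.
apply: (@fun_card_le _ _ _ _ (fun=> y)) => [//|u v -> ->//].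
Qed.

(** * A run with no cardinal stage past [a]: closing off and finding a repeated configuration *)

Section Loop.
Variables (W : ord) (a : W).
Implicit Types x y z u : W.

(** Uncountable cofinality of [o], stated so that one stage can be chosen per tape cell and all of
    them bounded below [o]. *)
Definition countably_closed o := forall (I : countType) (f : I -> W),
  (forall i, ord_lt (f i) o) -> exists2 u, ord_lt u o & forall i, ord_lt (f i) u.

(** The least [o] with [[a, o)] uncountable, that is [a + omega_1]: a countable family unbounded
    below [o] would write [[a, o)] as a countable union of countable sets. *)
Lemma exists_countably_closed t :
  ~ countable [set z | ord_le a z /\ ord_lt z t] ->
  exists o, [/\ ord_lt a o, ord_le o t & countably_closed o].
Proof.
pose J x := [set z | ord_le a z /\ ord_lt z x]; rewrite -/(J t) => tunc.
have [o [ounc omin]] := exists_least (ex_intro (fun x => ~ countable (J x)) t tunc).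
exists o; split; [|exact: omin|].
  apply: contrapT => /negP; rewrite -ord_leNgt => oa; apply: ounc.
  rewrite (_ : J o = set0) ?countable0// -subset0 => z [az zo].
  by have := ord_lt_le_trans (ord_le_lt_trans az zo) oa; rewrite ord_ltxx.
move=> I f fo; apply: contrapT => nu; apply: ounc.
have cJ x : ord_lt x o -> countable (J x).
  by move=> /negP xo; apply: contrapT => /omin.
apply: (@sub_countable _ _ _ (\bigcup_(i in [set: I]) J (f i) `|` range f)).
  apply: subset_card_le => z [az zo].
  have [i fi] : exists i, ord_le z (f i).
    apply: contrapT => nz; apply: nu; exists z => // i.
    by apply/negP => zf; apply: nz; exists i.
  have [->|zfi] := ord_le_eqVlt fi; first by right; exists i.
  by left; exists i.
have -> A B : A `|` B = \bigcup_(b in [set: bool]) if b then A else B :> set W.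
  by apply/seteqP; split=> [z [] ?|z [[] _ ?]]; [exists true|exists false|left|right].
apply: bigcup_countable => // -[] _.
  by apply: bigcup_countable => // i _; exact: cJ.
by apply: (sub_countable (card_image_le _ _)).
Qed.

Variables (M : crittm) (r : W -> config M).
Hypothesis run_r : is_run r.
Hypothesis no_cardinal : forall x, ord_lt a x -> ~ is_uncountable_cardinal x.

Lemma run_limit_above x : ord_lt a x -> is_limit x ->
  r x = limsup_config (limit_state M) r x.
Proof. by move=> ax xlim; apply: (run_limit run_r) => //; exact: no_cardinal. Qed.

(** Past [a] every limit stage has the limit state and the head on the first cell, so only the tapes
    can differ. *)
Lemma eq_limsup_config x y : ord_lt a x -> is_limit x -> ord_lt a y -> is_limit y ->
  (forall i n, ctape (r x) i n = ctape (r y) i n) -> r x = r y.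
Proof.
move=> ax xlim ay ylim; rewrite !run_limit_above//= => E.
by congr Config; apply/funext => i; apply/funext => n; exact: E.
Qed.

Lemma ctape_limitP x i n : ord_lt a x -> is_limit x ->
  reflect (forall z, ord_lt z x ->
             exists y, [/\ ord_le z y, ord_lt y x & ctape (r y) i n])
          (ctape (r x) i n).
Proof. by move=> ax xlim; rewrite run_limit_above//=; exact: asboolP. Qed.

Lemma ctape_limitPn x i n : ord_lt a x -> is_limit x ->
  reflect (exists2 z, ord_lt z x &
             forall y, ord_le z y -> ord_lt y x -> ctape (r y) i n = false)
          (~~ ctape (r x) i n).
Proof.
move=> ax xlim; apply: (iffP negP) => [nT|].
  have /existsNP[z /not_implyP[zx nz]] :=
    contra_not (introT (ctape_limitP i n ax xlim)) nT.
  exists z => // y zy yx.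
  by apply/negP => yin; apply: nz; exists y.
move=> [z zx h] /(ctape_limitP _ _ ax xlim)/(_ z zx)[y [zy yx]].
by rewrite h.
Qed.

Variable o : W.
Hypothesis ao : ord_lt a o.
Hypothesis o_closed : countably_closed o.

Lemma countably_closed_limit : is_limit o.
Proof.
apply: (is_limit_intro ao) => z zo.
by have [u uo /(_ tt) zu] := @o_closed unit (fun=> z) (fun=> zo); exists u.
Qed.
Let o_lim := countably_closed_limit.

(* Past [d0] the cells that are 0 at stage [o] stay 0; climbing [omega] times from
   [d0], each time far enough for every other cell to show a 1, gives [d]. *)
Lemma exists_repeat : exists d, [/\ ord_lt a d, ord_lt d o, r d = r o &
  forall y i n, ord_le d y -> ord_lt y o ->
    ctape (r o) i n = false -> ctape (r y) i n = false].
Proof.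
pose cell : countType := ('I_3 * nat)%type.
have [d0 [ad0 d0o d0P]] : exists d0, [/\ ord_lt a d0, ord_lt d0 o &
    forall y i n, ord_le d0 y -> ord_lt y o ->
      ctape (r o) i n = false -> ctape (r y) i n = false].
  have ex (c : cell) : exists z, ord_lt z o /\ (ctape (r o) c.1 c.2 = false ->
      forall y, ord_le z y -> ord_lt y o -> ctape (r y) c.1 c.2 = false).
    have [_|/(ctape_limitPn _ _ ao o_lim)[z zo zP]] :=
      boolP (ctape (r o) c.1 c.2); first by exists a.
    by exists z.
  have [f fP] := choice ex.
  (* [None] stands for the extra stage [a], so that the common bound also lies above [a]. *)
  have [|u uo uP] :=
      @o_closed (option cell) (fun c => if c is Some c then f c else a).
    by case=> [c|//]; exact: (fP c).1.
  exists u; split=> [||y i n uy yo /((fP (i, n)).2) h]//.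
    exact: (uP None).
  by apply: h => //; apply: ord_le_trans uy; exact: ord_ltW (uP (Some (i, n))).
have ex z : exists u, ord_lt z o -> [/\ ord_lt u o, ord_lt z u &
    forall i n, ctape (r o) i n ->
      exists y, [/\ ord_le z y, ord_lt y u & ctape (r y) i n]].
  have [zo|] := pselect (ord_lt z o); last by exists z.
  have exc (c : cell) : exists y, ord_lt y o /\ (ctape (r o) c.1 c.2 ->
      ord_le z y /\ ctape (r y) c.1 c.2).
    have [/(ctape_limitP _ _ ao o_lim)/(_ _ zo)[y [zy yo yP]]|_] :=
      boolP (ctape (r o) c.1 c.2); last by exists z.
    by exists y.
  have [f fP] := choice exc.
  have [|u uo uP] :=
      @o_closed (option cell) (fun c => if c is Some c then f c else z).
    by case=> [c|//]; exact: (fP c).1.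
  exists u => _; split=> [//||i n /((fP (i, n)).2)[zf fT]]; first exact: (uP None).
  by exists (f (i, n)); split=> //; exact: (uP (Some (i, n))).
have [g gP] := choice ex.
pose s k := iter k g d0.
have so k : ord_lt (s k) o by elim: k => //= k /gP[].
have [u uo uP] := @o_closed nat s so.
(* [d] is the supremum of the strictly increasing [s k], hence a limit; it stays below [o] by
   closure under countable families. *)
have [d [sd dmin]] := exists_least (ex_intro (fun u => forall k, ord_lt (s k) u) u uP).
have dP z : ord_lt z d -> exists k, ord_le z (s k).
  move=> /negP zd; apply: contrapT => nk; apply/zd/dmin => k.
  by apply/negP => zs; apply: nk; exists k.
have ad : ord_lt a d by exact: ord_lt_trans (sd 0).
have d_o : ord_lt d o by apply: ord_le_lt_trans uo; exact: dmin.
have dlim : is_limit d.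
  apply: (is_limit_intro ad) => z /dP[k zk]; exists (s k.+1) => //.
  by apply: ord_le_lt_trans zk _; have [] := gP _ (so k).
have d0d y : ord_le d y -> ord_le d0 y.
  by apply: ord_le_trans; exact: ord_ltW (sd 0).
exists d; split=> // [|y i n /d0d]; last exact: d0P.
apply: eq_limsup_config => // i n.
have [E|/negbTE E] := boolP (ctape (r o) i n).
  apply/(ctape_limitP _ _ ad dlim) => z /dP[k zk].
  have [_ _ /(_ i n E)[y [ky yk yT]]] := gP _ (so k).
  exists y; split=> //; first exact: ord_le_trans ky.
  exact: ord_lt_trans (sd k.+1).
apply/negbTE/(ctape_limitPn _ _ ad dlim); exists d0; first exact: (sd 0).
by move=> y d0y yd; apply: d0P => //; exact: ord_lt_trans d_o.
Qed.

(** * Repeating the block [[d, o)] forever *)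

Variable d : W.
Hypotheses (ad : ord_lt a d) (d_lt_o : ord_lt d o) (r_repeat : r d = r o).
Hypothesis zeros_stay : forall y i n, ord_le d y -> ord_lt y o ->
  ctape (r o) i n = false -> ctape (r y) i n = false.

Section Simulation.
Variables z y0 : W.
Hypotheses (dz : ord_le d z) (rz : r z = r o).
Hypothesis no_repeat : forall y, ord_lt z y -> ord_le y y0 -> r y <> r o.

(** The recursion equation of the shift. [F] takes a proof of [ord_lt y' y], as well-founded
    recursion requires; only its values from [z] on count, so the value at [z] itself is [d]. *)
Definition least_strict_bound y (F : forall y', ord_lt y' y -> W) m :=
  [/\ ord_le d m, forall y' (h : ord_lt y' y), ord_le z y' -> ord_lt (F y' h) m &
    forall x, ord_le d x ->
      (forall y' (h : ord_lt y' y), ord_le z y' -> ord_lt (F y' h) x) -> ord_le m x].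

(* [F (z + e) = d + e] *)
Lemma exists_shift : exists F : W -> W, forall y,
  (exists2 x, ord_le d x &
    forall y', ord_le z y' -> ord_lt y' y -> ord_lt (F y') x) ->
  @least_strict_bound y (fun y' _ => F y') (F y).
Proof.
have ex y (F : forall y', ord_lt y' y -> W) : {m |
    (exists2 x, ord_le d x &
      forall y' (h : ord_lt y' y), ord_le z y' -> ord_lt (F y' h) x) ->
    least_strict_bound F m}.
  apply: cid; have [[x dx xP]|nx] := pselect (exists2 x, ord_le d x &
    forall y' (h : ord_lt y' y), ord_le z y' -> ord_lt (F y' h) x); last first.
    (* With no bound available the value is a default, and the specification is vacuous. *)
    by exists d => /nx.
  have [m [[dm mP] mmin]] := exists_least (ex_intro (fun x => ord_le d x /\
    forall y' (h : ord_lt y' y), ord_le z y' -> ord_lt (F y' h) x) x (conj dx xP)).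
  by exists m => _; split=> // u du uP; apply: mmin.
pose F := Fix (@ord_lt_wf W) (fun=> W) (fun y G => sval (ex y G)).
exists F => y [x dx xP].
have -> : F y = sval (ex y (fun y' _ => F y')).
  rewrite {1}/F Fix_eq// => u f g fg; congr (sval (ex _ _)).
  by apply/functional_extensionality_dep => v; apply/functional_extensionality_dep.
by apply: (svalP (ex y (fun y' _ => F y'))); exists x => // y' h zy'; exact: xP.
Qed.

(** The shift [F] is an order isomorphism of [[z, y)] onto [[d, F y)], so successor steps and
    limsups agree on both sides. It cannot reach [o], since that would repeat the configuration of
    [o] after [z]. *)
Lemma simulation : ord_le z y0 ->
  exists x, [/\ ord_le d x, ord_lt x o & r y0 = r x].
Proof.
have [F FP] := exists_shift => zy0.
suff H y : ord_le z y -> ord_le y y0 -> ord_lt (F y) o /\ r y = r (F y).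
  have [Fo rE] := H _ zy0 (ord_lexx _); exists (F y0); split=> //.
  have [|//] := FP y0; exists o; first exact: ord_ltW.
  move=> y' zy' y'y0; exact: (H y' zy' (ord_ltW y'y0)).1.
elim/ord_lt_ind: y => y IH zy yy0.
have {}IH y' : ord_le z y' -> ord_lt y' y -> ord_lt (F y') o /\ r y' = r (F y').
  by move=> zy' y'y; apply: IH => //; apply: ord_le_trans yy0; exact: ord_ltW.
(* By induction the earlier values lie below [o], which supplies the bound that [FP] asks for. *)
have bounded y' : ord_le y' y -> @least_strict_bound y' (fun y _ => F y) (F y').
  move=> y'y; apply: FP; exists o; first exact: ord_ltW.
  by move=> u zu uy'; apply: (IH u zu _).1; exact: ord_lt_le_trans y'y.
have Fd y' : ord_le y' y -> ord_le d (F y') by move=> /bounded[].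
have Fz : F z = d.
  have [dF _ h] := bounded _ zy; apply: ord_le_anti => //.
  by apply: h => // y' /negP.
have Flt u v : ord_le z u -> ord_lt u v -> ord_le v y -> ord_lt (F u) (F v).
  by move=> zu uv /bounded[_ h _]; exact: h.
have Fle u v : ord_le z u -> ord_le u v -> ord_le v y -> ord_le (F u) (F v).
  by move=> zu /ord_le_eqVlt[->//|uv] vy; apply: ord_ltW; exact: Flt.
(* The shift skips no stage: for the least [w] with [x <= F w], [x] strictly bounds the earlier
   values, so [F w <= x]. *)
have Fsurj x : ord_le d x -> ord_lt x (F y) ->
    exists y', [/\ ord_le z y', ord_lt y' y & F y' = x].
  move=> dx xy.
  have [w [[zw wy xw] wmin]] : exists w, [/\ ord_le z w, ord_lt w y & ord_le x (F w)] /\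
      forall u, [/\ ord_le z u, ord_lt u y & ord_le x (F u)] -> ord_le w u.
    apply: exists_least; apply: contrapT => nw; have [_ _ h] := bounded _ (ord_lexx y).
    move/negP: xy; apply; apply: h => // u uy zu; apply/negP => xu.
    by apply: nw; exists u.
  exists w; split=> //; apply: ord_le_anti => //.
  have [_ _] := bounded _ (ord_ltW wy); apply=> // u uw zu.
  apply/negP => xu; move/negP: (uw); apply; apply: wmin; split=> //.
  exact: ord_lt_trans uw wy.
have rE : r y = r (F y).
  have [yE|zlty] := ord_le_eqVlt zy.
    by rewrite -yE Fz rz r_repeat.
  have ay : ord_lt a y by apply: ord_lt_trans zlty; exact: ord_lt_le_trans dz.
  have aFy : ord_lt a (F y) by apply: ord_lt_le_trans (Fd _ _).
  have dFy : ord_lt d (F y) by rewrite -Fz; exact: Flt.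
  have [[p py]|ylim] := succ_or_limit zlty.
    have zp : ord_le z p by exact: is_succ_of_le py zlty.
    have Fp : is_succ_of (F p) (F y).
      split=> [|x]; first by apply: Flt => //; exact: py.1.
      apply/negP => /andP[px xy].
      have [|//|y' [zy' y'y E]] := Fsurj x.
        by apply: ord_le_trans (ord_ltW px); apply: Fd; exact: ord_ltW py.1.
      move/negP: px; apply; rewrite -E; apply: Fle => //; last exact: ord_ltW py.1.
      exact: is_succ_of_le py y'y.
    by rewrite (run_succ run_r py) (run_succ run_r Fp) (IH p zp py.1).2.
  have Flim : is_limit (F y).
    apply: (is_limit_intro dFy) => x xy.
    have [m [xm dm /(_ _ xy dFy) my]] := exists_ord_max x d.
    have [y' [zy' y'y y'E]] := Fsurj _ dm my.
    have [u [y'u uy]] := is_limit_lt ylim y'y; exists (F u).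
      by apply: ord_le_lt_trans xm _; rewrite -y'E; apply: Flt y'u.1 _ => //; exact: ord_ltW.
    by apply: Flt => //; apply: ord_le_trans zy' (ord_ltW y'u.1).
  (* A limsup depends only on a final segment, so it passes through the isomorphism; taking the
     maximum with [d] or [z] moves a given stage into the range where [F] is controlled. *)
  apply: eq_limsup_config => // i n; apply/idP/idP.
    move=> /(ctape_limitP _ _ ay ylim) h; apply/(ctape_limitP _ _ aFy Flim) => x xy.
    have [m [xm dm /(_ _ xy dFy) my]] := exists_ord_max x d.
    have [y' [zy' y'y y'E]] := Fsurj _ dm my.
    have [u [y'u uy uT]] := h _ y'y; have zu := ord_le_trans zy' y'u.
    exists (F u); split; last by rewrite -(IH u zu uy).2.
      by apply: ord_le_trans xm _; rewrite -y'E; apply: Fle => //; exact: ord_ltW.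
    exact: Flt.
  move=> /(ctape_limitP _ _ aFy Flim) h; apply/(ctape_limitP _ _ ay ylim) => y' y'y.
  have [m [y'm zm /(_ _ y'y zlty) my]] := exists_ord_max y' z.
  have [x [mx xy xT]] := h _ (Flt _ _ zm my (ord_lexx _)).
  have [|u [zu uy uE]] := Fsurj x _ xy.
    by apply: ord_le_trans mx; apply: Fd; exact: ord_ltW.
  exists u; split=> //; last by rewrite (IH u zu uy).2 uE.
  apply: ord_le_trans y'm _; rewrite ord_leNgt; apply/negP => um.
  by have := Flt _ _ zu um (ord_ltW my); rewrite uE ord_ltNge mx.
split=> //.
(* [o] bounds the earlier values strictly, so the least bound is at most [o]; equality remains to be
   excluded. *)
have : ord_le (F y) o.
  have [_ _] := bounded _ (ord_lexx y); apply; first exact: ord_ltW.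
  by move=> y' y'y zy'; exact: (IH y' zy' y'y).1.
move=> /ord_le_eqVlt[FE|//].
have [yE|zlty] := ord_le_eqVlt zy; last by case: (no_repeat zlty yy0); rewrite rE FE.
by rewrite -yE Fz.
Qed.

End Simulation.

(* Stages with the configuration of [o] are closed under limits, so there is a last
   one [z <= y]; the run from [z] up to [y] is then a copy of the run from [d]. *)
Lemma loop_forever y : ord_le d y ->
  exists x, [/\ ord_le d x, ord_lt x o & r y = r x].
Proof.
elim/ord_lt_ind: y => y IH dy.
have zeros y' i n : ord_le d y' -> ord_lt y' y ->
    ctape (r o) i n = false -> ctape (r y') i n = false.
  by move=> dy' y'y; have [x [dx xo ->]] := IH _ y'y dy'; exact: zeros_stay.
pose Z z := [/\ ord_le d z, ord_le z y & r z = r o].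
(* [s] is the supremum of [Z]; once it is known to lie in [Z], it is the last repetition up to
   [y]. *)
have [s [[sy sub] smin]] : exists s, (ord_le s y /\ forall z, Z z -> ord_le z s) /\
    forall u, (ord_le u y /\ forall z, Z z -> ord_le z u) -> ord_le s u.
  by apply: exists_least; exists y; split=> // z [].
have ds : ord_le d s by apply: sub.
suff rs : r s = r o.
  apply: (simulation ds rs) => // u su uy ru.
  move/negP: (su); apply; apply: sub; split=> //.
  by apply: ord_le_trans ds _; exact: ord_ltW.
apply: contrapT => rs.
have Zlt z : Z z -> ord_lt z s.
  by move=> Zz; have [zE|//] := ord_le_eqVlt (sub _ Zz); case: Zz; rewrite zE.
have Zcof u : ord_lt u s -> exists2 z, Z z & ord_lt u z.
  move=> us; apply: contrapT => nz; move/negP: (us); apply; apply: smin; split.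
    by apply: ord_le_trans (ord_ltW us) sy.
  by move=> z Zz; rewrite ord_leNgt; apply/negP => uz; apply: nz; exists z.
have as_ : ord_lt a s by exact: ord_lt_le_trans ds.
have slim : is_limit s.
  by apply: (is_limit_intro as_) => u /Zcof[z /Zlt]; exists z.
apply: rs; apply: eq_limsup_config => // i n.
(* Cells that are 1 at [o] are 1 at the stages of [Z], cofinal in [s]; the others are 0 throughout
   [[d, s)]. *)
have [E|/negbTE E] := boolP (ctape (r o) i n).
  apply/(ctape_limitP _ _ as_ slim) => u /Zcof[z Zz uz]; exists z.
  by split; [exact: ord_ltW|exact: Zlt|case: Zz => _ _ ->].
apply/negbTE/(ctape_limitPn _ _ as_ slim); exists d.
  by apply: Zlt; split.
by move=> u du us; apply: zeros => //; exact: ord_lt_le_trans sy.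
Qed.

End Loop.

(** * Non-halting, and the application to [alpha + beta] *)

Lemma no_halt_after_uncountable (W : ord) (a t : W) (M : crittm) (r : W -> config M) :
  is_run r -> (forall x, ord_lt a x -> ~ is_uncountable_cardinal x) ->
  ~ countable [set z | ord_le a z /\ ord_lt z t] ->
  (forall x, cstate (r x) <> halt_state M) ->
  cstate (step (r t)) <> halt_state M.
Proof.
move=> run_r no_card unc no_halt.
have [o [ao ot o_closed]] := exists_countably_closed unc.
have [d [ad d_o rd zeros]] := exists_repeat run_r no_card ao o_closed.
have [|x [dx xo ->]] := loop_forever run_r no_card ao o_closed ad d_o rd zeros (y := t).
  by apply: ord_le_trans ot; exact: ord_ltW.
(* [t] may be the last point of [W], but its copy [x < o] has a successor stage, where the run shows
   the step and is not halted. *)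
have [y [xy _]] := is_limit_lt (countably_closed_limit ao o_closed) xo.
by rewrite -(run_succ run_r xy).
Qed.

Theorem theorem2 (alpha beta : ord)
  (card_ge : [set: beta] #<= [set: alpha])
  (clock : crittm_clockable (ord_add alpha beta)) :
  countable [set: beta].
Proof.
apply: contrapT => beta_unc; case: clock => M [r [run_r no_halt]].
(* The least element of [beta] represents stage [alpha] in the sum; below, [B] is the interval from
   [alpha] up to, but excluding, [alpha + beta]. *)
have [b [_ bmin]] : exists b : beta, True /\ forall c, True -> ord_le b c.
  apply: exists_least; apply: contrapT => nb; apply: beta_unc.
  rewrite (_ : [set: beta] = set0) ?countable0// -subset0 => c _.
  by apply: nb; exists c.
pose W := ord_succ (ord_add alpha beta).
pose stageA (x : alpha) : W := inl (inl x); pose stageB (c : beta) : W := inl (inr c).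
pose a := stageB b; pose B := [set z : W | ord_le a z /\ ord_lt z (ord_top _)].
have aE : initial_segment a = range stageA.
  apply/seteqP; split=> [[[x|c]|[]]|_ [x _ <-]]//.
  by rewrite /initial_segment /= /ord_lt /= bmin.
have BE : B = range stageB.
  apply/seteqP; split=> [[[x|c]|[]] [? ?]|_ [c _ <-]]//.
  by split=> //=; exact: bmin.
have cA : initial_segment a #= [set: alpha].
  by rewrite aE; apply: inj_card_eq => x y _ _ [].
have cB : B #= [set: beta].
  by rewrite BE; apply: inj_card_eq => x y _ _ [].
have B_le_a : B #<= initial_segment a.
  by rewrite (card_le_eql cB) (card_le_eqr cA).
(* A stage [x] past [a] is no cardinal: its predecessors lie in the segment of [a] together with
   [B], and that infinite segment absorbs [B]. *)
apply: (no_halt_after_uncountable (a := a) run_r _ _ no_halt) => [x ax [xcard _]|].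
  apply: (xcard _ ax); apply/card_eqPle; split.
    by apply: subset_card_le => y ya; exact: ord_lt_trans ax.
  have a_inf : infinite_set (initial_segment a).
    move=> a_fin; apply: beta_unc; rewrite -(eq_countable cB).
    by apply: sub_countable B_le_a _; exact: finite_set_countable.
  have /card_eqPle[+ _] := card_setU_doubled (doubled_initial_segment a_inf) B_le_a.
  apply: card_le_trans; apply: subset_card_le => y yx.
  have [ay|ya] := ord_leVgt a y; [right|by left].
  by split=> //; apply: ord_lt_le_trans yx _; case: (x).
by rewrite -/B (eq_countable cB).
Qed.
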